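(* Let $\{B_i : i\in\mathbb{N}\}$ be a family of infinite subsets of $\mathbb{N}$ such that, for some fixed $n\in\mathbb{N}$, $|B_i\cap B_j|=n$ for all $i\neq j$. Then the inverse subsemigroup of $I(\mathbb{N})$ generated by $\bigcup_{i\in\mathbb{N}}S_\infty(B_i)$ is Polish (in the subspace topology from $I(\mathbb{N})$).
   Context: $\mathbb{N}$ denotes the non-negative integers. $I(\mathbb{N})$ is the set of all bijections $f:A\to B$ with $A,B\subseteq\mathbb{N}$ (including the empty function $1_\emptyset$); write $\mathrm{dom}(f)=A$, $\mathrm{im}(f)=B$. The operation is composition of partial functions: $\mathrm{dom}(f\circ g)=g^{-1}(\mathrm{dom}(f)\cap\mathrm{im}(g))$ and $(f\circ g)(x)=f(g(x))$. It is an inverse semigroup, the inverse of $f$ being the inverse function $f^{-1}:B\to A$. The topology $\tau_{pp}$ on $I(\mathbb{N})$ is generated (as a subbase) by the sets $v(x,y)=\{f: x\in\mathrm{dom}(f),\ f(x)=y\}$, $w_1(x)=\{f: x\notin\mathrm{dom}(f)\}$, $w_2(y)=\{f: y\notin\mathrm{im}(f)\}$ for $x,y\in\mathbb{N}$; with it, $I(\mathbb{N})$ is a Polish topological inverse semigroup (composition and inversion are continuous). $I(\mathbb{N})$ always carries $\tau_{pp}$. For $B\subseteq\mathbb{N}$, $S_\infty(B)$ is the group of all bijections from $B$ to $B$, viewed as a subset of $I(\mathbb{N})$. The inverse subsemigroup generated by a set is the smallest subset containing it and closed under composition and inversion. *)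

(* Defs.v *)
From HB Require Import structures.
From mathcomp Require Import all_boot all_order all_algebra.
From mathcomp Require Import all_classical all_reals all_analysis.

Set Implicit Arguments.
Unset Strict Implicit.
Unset Printing Implicit Defensive.

Local Open Scope classical_set_scope.

(* [pbij] is I(N): a bijection between subsets of N is encoded as an
   option-valued function, undefined (None) exactly outside its domain;
   the codomain is the image, so only injectivity on the domain is needed. *)
Record pbij := PBij {
  pfun :> nat -> option nat;
  pfun_inj : forall x y z, pfun x = Some z -> pfun y = Some z -> x = y }.

HB.instance Definition _ := gen_eqMixin pbij.
HB.instance Definition _ := gen_choiceMixin pbij.

Definition dom (f : pbij) : set nat := [set x | exists y, f x = Some y].
Definition im (f : pbij) : set nat := [set y | exists x, f x = Some y].

Lemma pbij_ext (f g : pbij) : f =1 g -> f = g.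
Proof.
case: f g => f fI [g gI] /= /funext fg; rewrite fg in fI *.
by congr PBij; exact: Prop_irrelevance.
Qed.

Lemma pcomp_subproof (f g : pbij) x y z :
  pcomp f g x = Some z -> pcomp f g y = Some z -> x = y.
Proof.
rewrite /pcomp; case gx: (g x) => [a|] //=; case gy: (g y) => [b|] //= fa fb.
have ab := pfun_inj fa fb; rewrite {}ab in gx.
exact: pfun_inj gx gy.
Qed.

(* f after g *)
Definition pbij_comp (f g : pbij) : pbij := PBij (@pcomp_subproof f g).

Definition pinv (f : pbij) (y : nat) : option nat :=
  xget None [set Some x | x in [set x | f x = Some y]].

Lemma pinvP (f : pbij) x y : pinv f y = Some x <-> f x = Some y.
Proof.
rewrite /pinv; split=> [|fx]; first by case: xgetP => // _ _ [a /= fa <-] [<-].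
case: xgetP => [_ _ [a /= fa <-]|/(_ (Some x))]; first by rewrite (pfun_inj fa fx).
by move=> []; exists x.
Qed.

Lemma pinv_subproof (f : pbij) x y z :
  pinv f x = Some z -> pinv f y = Some z -> x = y.
Proof. by move=> /pinvP fx /pinvP; rewrite fx => -[]. Qed.

Definition pbij_inv (f : pbij) : pbij := PBij (@pinv_subproof f).

Lemma dom_pbij_comp (f g : pbij) :
  dom (pbij_comp f g) =
  [set x | exists2 y, g x = Some y & (dom f `&` im g) y].
Proof.
apply/seteqP; split => x /=.
  case=> z; rewrite /= /pcomp; case gx: (g x) => [y|] //= fy.
  by exists y => //; split; [exists z | exists x].
by case=> y gx [[z fy] _]; exists z; rewrite /= /pcomp gx.
Qed.

Lemma dom_pbij_inv (f : pbij) : dom (pbij_inv f) = im f.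
Proof. by apply/seteqP; split => y [x /pinvP fx]; exists x. Qed.

Lemma im_pbij_inv (f : pbij) : im (pbij_inv f) = dom f.
Proof. by apply/seteqP; split => x [y /pinvP fx]; exists y. Qed.

Definition v (x y : nat) : set pbij := [set f | f x = Some y].
Definition w1 (x : nat) : set pbij := [set f | ~ dom f x].
Definition w2 (y : nat) : set pbij := [set f | ~ im f y].

Definition tau_pp_subbase : set (set pbij) :=
  [set v xy.1 xy.2 | xy in [set: nat * nat]] `|` range w1 `|` range w2.

HB.instance Definition _ :=
  isSubBaseTopological.Build pbij tau_pp_subbase id.

Definition Sinfty (B : set nat) : set pbij := [set f | dom f = B /\ im f = B].

Definition inverse_subsemigroup (S : set pbij) : Prop :=
  (forall f g, S f -> S g -> S (pbij_comp f g)) /\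
  (forall f, S f -> S (pbij_inv f)).

Definition generated_inverse_subsemigroup (A : set pbij) : set pbij :=
  smallest inverse_subsemigroup A.

Definition separable (T : topologicalType) : Prop :=
  exists2 D : set T, countable D & dense D.

(* [completeType] is not used for M because it requires a base point. *)
Definition completely_metrizable (R : realType) (T : topologicalType) : Prop :=
  exists (M : metricType R) (f : T -> M) (g : M -> T),
    [/\ cancel f g, cancel g f, continuous f, continuous g &
      forall F : set_system M, ProperFilter F -> cauchy F ->
        exists x : M, F --> x].

Definition polish (R : realType) (T : topologicalType) : Prop :=
  separable T /\ completely_metrizable R T.

(* Main.v *)
(* Write I_n for the set of partial bijections of rank at most n.  The union X
   of I_n and of all the S_oo(B_i) is an inverse subsemigroup, because a product
   of elements of S_oo(B_i) and S_oo(B_j), i <> j, has rank at most n.  X is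
   closed: n + 1 points of the domain are contained in at most one B_i, so near
   an f of rank > n the set X reduces to a single S_oo(B_i), which is closed.
   The generated semigroup G contains every S_oo(B_i), so X \ G is a subset of
   the countable set I_n.  Hence G is a G_delta subset of the Polish space I(N),
   and is Polish. *)
Require Import Defs.
From HB Require Import structures.
From mathcomp Require Import all_boot all_order all_algebra finmap.
From mathcomp Require Import all_classical all_reals all_analysis.

Set Implicit Arguments.
Unset Strict Implicit.
Unset Printing Implicit Defensive.

Import Order.TTheory GRing.Theory Num.Theory.

Local Open Scope classical_set_scope.

(** * Topologies given by complete discrete coordinates *)

Definition agree (T E : Type) (c : nat -> T -> E) (m : nat) (x : T) : set T :=
  [set y | forall i, (i < m)%N -> c i x = c i y].

Lemma agree_le (T E : Type) (c : nat -> T -> E) m k x :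
  (m <= k)%N -> agree c k x `<=` agree c m x.
Proof. by move=> mk y xy i im; apply: xy; exact: leq_trans im mk. Qed.

Lemma agree_eq (T E : Type) (c : nat -> T -> E) m x y :
  agree c m x y -> agree c m x = agree c m y.
Proof.
move=> xy; apply/seteqP; split=> z xz i im; first by rewrite -xy// xz.
by rewrite xy// xz.
Qed.

(* [x |-> (c i x)_i] is a homeomorphism onto a closed subset of [E ^ nat],
   the countable set [E] being discrete. *)
Record complete_coords (T : topologicalType) (E : countType)
    (c : nat -> T -> E) : Prop := CompleteCoords {
  coord_near : forall i x, \forall y \near x, c i x = c i y;
  nbhs_coord : forall x U, nbhs x U -> exists m, agree c m x `<=` U;
  coord_inj : forall x y, (forall i, c i x = c i y) -> x = y;
  coord_lim : forall s : nat -> E,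
    (forall m, exists x, forall i, (i < m)%N -> c i x = s i) ->
    exists x, forall i, c i x = s i }.

Lemma nbhs_agree (T : topologicalType) (E : countType) (c : nat -> T -> E) m x :
  complete_coords c -> nbhs x (agree c m x).
Proof.
move=> cc; elim: m => [|m IH]; first by apply: filterS filterT => y _ i.
have mx := coord_near cc m x.
apply: filterS2 IH mx => y xy my i.
by rewrite ltnS leq_eqVlt => /predU1P[->//|]; exact: xy.
Qed.

(** * The first-difference metric and Polishness *)

Section first_difference_metric.
Context (R : realType) (T : choiceType) (E : eqType) (c : nat -> T -> E).
Hypothesis c_inj : forall x y, (forall i, c i x = c i y) -> x = y.
Local Open Scope ring_scope.

(** The shift [.+1] keeps the distance positive when coordinate 0 already differs, since [0^-1] is
    [0]. *)
Definition fdist (x y : T) : R :=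
  if pselect (exists m, c m x != c m y) is left h
  then (ex_minn h).+1%:R^-1 else 0.

Lemma fdist_ge x y k : c k x != c k y -> k.+1%:R^-1 <= fdist x y.
Proof.
move=> ck; rewrite /fdist; case: pselect => [h|[]]; last by exists k.
case: ex_minnP => m _ /(_ _ ck) mk.
by rewrite lef_pV2 ?posrE ?ltr0n// ler_nat ltnS.
Qed.

Lemma fdist_ltP x y m : fdist x y < m.+1%:R^-1 <-> agree c m.+1 x y.
Proof.
split=> [xym i im|xy].
  have [//|ci] := eqVneq (c i x) (c i y); have := le_lt_trans (fdist_ge ci) xym.
  by rewrite ltf_pV2 ?posrE ?ltr0n// ltr_nat ltnNge im.
rewrite /fdist; case: pselect => [h|_]; last by rewrite invr_gt0 ltr0n.
case: ex_minnP => k ck _; rewrite ltf_pV2 ?posrE ?ltr0n// ltr_nat ltnS.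
by rewrite ltnNge; apply: contra ck => km; apply/eqP; apply: xy.
Qed.

Lemma fdistxx x : fdist x x = 0.
Proof. by rewrite /fdist; case: pselect => // h; have [m] := h; rewrite eqxx. Qed.

Lemma fdist_ge0 x y : 0 <= fdist x y.
Proof. by rewrite /fdist; case: pselect => // h; rewrite invr_ge0. Qed.

Lemma fdist_eq0 x y : fdist x y = 0 -> x = y.
Proof.
move=> xy0; apply: c_inj => i; have [//|/fdist_ge] := eqVneq (c i x) (c i y).
by rewrite xy0 leNgt invr_gt0 ltr0n.
Qed.

Lemma fdistC x y : fdist x y = fdist y x.
Proof.
rewrite /fdist; case: pselect => [h|nh]; case: pselect => [h'|nh']//.
- by congr (_.+1%:R^-1); apply: eq_ex_minn => m; rewrite eq_sym.
- by case: nh'; case: h => m; exists m; rewrite eq_sym.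
- by case: nh; case: h' => m; exists m; rewrite eq_sym.
Qed.

(** At the first index where [x] and [z] differ, [y] differs from one of them, so one summand alone
    is large enough. *)
Lemma fdist_triangle y x z : fdist x z <= fdist x y + fdist y z.
Proof.
rewrite {1}/fdist; case: pselect => [h|_]; last by rewrite addr_ge0// fdist_ge0.
case: ex_minnP => m cm _.
have [xy|/fdist_ge/le_trans->//] := eqVneq (c m x) (c m y); last first.
  by rewrite lerDl fdist_ge0.
by rewrite xy in cm; apply: le_trans (fdist_ge cm) _; rewrite lerDr fdist_ge0.
Qed.

(* The phantom dependencies on [c_inj] and [R] let instance resolution recover
   the metric from the type. *)
Definition first_difference_space : Type := let _ := c_inj in let _ := R in T.
HB.instance Definition _ := Choice.on first_difference_space.
HB.instance Definition _ := @isMetric.Build R first_difference_space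
  fdist fdistxx fdist_eq0 fdistC fdist_triangle.

Lemma ball_first_difference (x : first_difference_space) m :
  ball x (m.+1%:R^-1 : R) = agree c m.+1 x.
Proof.
rewrite -metricType_numDomainType.ball_mdistE.
by apply/seteqP; split=> y /= /fdist_ltP.
Qed.

Lemma nbhs_first_difference (x : first_difference_space) U :
  nbhs x U <-> exists m, agree c m x `<=` U.
Proof.
split=> [/nbhs_ballP[e e0 xU]|[m mU]].
  have [k _ /(_ k (leqnn _)) ke] := near_infty_natSinv_lt (PosNum e0).
  exists k.+1; rewrite -ball_first_difference.
  by apply: subset_trans xU; apply: le_ball; exact: ltW.
apply/nbhs_ballP; exists m.+1%:R^-1 => /=; first by rewrite invr_gt0 ltr0n.
by rewrite ball_first_difference => y xy; apply: mU; apply: agree_le xy.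
Qed.

End first_difference_metric.

Lemma polish_complete_coords (R : realType) (T : topologicalType)
  (E : countType) (c : nat -> T -> E) : complete_coords c -> polish R T.
Proof.
move=> cc; split.
  (* One point per realised finite word gives a countable dense set; [option] supplies the default
     [None] for words that no point of [T] starts with. *)
  pose P (s : seq E) := [set Some x | x in
    [set x | mkseq (c^~ x) (size s) = s]].
  exists (\bigcup_(s : seq E) [set x | xget None (P s) = Some x]).
    apply: bigcup_countable => // s _; case: (xget None (P s)) => [x|].
      by apply: (@sub_countable _ _ _ [set x]);
        [apply: subset_card_le => y [->]|].
    by apply: (@sub_countable _ _ _ set0); [apply: subset_card_le|].
  move=> O [x Ox] oO.
  have [m mO] := nbhs_coord cc (open_nbhs_nbhs (conj oO Ox)).
  pose s := mkseq (c^~ x) m.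
  have [z zs zE] : P s (xget None (P s)).
    by apply: xgetPex; exists (Some x), x => //=; rewrite size_mkseq.
  exists z; split; last by exists s.
  apply: mO => i im; move: zs; rewrite size_mkseq => /(congr1 (nth (c 0 x) ^~ i)).
  by rewrite !nth_mkseq.
pose M := first_difference_space R (coord_inj cc).
exists M, id, id; split=> //.
- move=> x U /nbhs_first_difference[m mU].
  by apply: filterS (nbhs_agree m x cc).
- move=> x U /(nbhs_coord cc) xU; exact/nbhs_first_difference.
move=> F FF /cauchyP cF.
have /choice[x_ Fx] m : exists x, F (agree c m.+1 x).
  have [|x] := cF m.+1%:R^-1%R; first by rewrite invr_gt0 ltr0n.
  by rewrite ball_first_difference; exists x.
(* Two sets of the filter meet, so the approximants are consistent and the diagonal [c i (x_ i)] is
   the word of the limit. *)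
have x_E m i : (i <= m)%N -> c i (x_ m) = c i (x_ i).
  move=> im; have [z [mz iz]] := filter_ex (filterI (Fx m) (Fx i)).
  by rewrite mz// iz.
have [|x xE] := coord_lim cc (s := fun i => c i (x_ i)).
  by move=> m; exists (x_ m) => i /ltnW/x_E.
exists x => U /nbhs_first_difference[m mU].
apply: filterS (Fx m) => y xy; apply: mU => i im.
by rewrite xE -xy ?x_E ?leqW// ltnW.
Qed.

(** * Coordinates on G_delta subsets *)

(* Remembering at which stage a point of an open set [U] is known to lie in [U]
   prevents Cauchy sequences of [U] from converging outside [U]; the value is
   the junk [0] off [U]. *)
Definition rank (T E : Type) (c : nat -> T -> E) (U : set T) (x : T) : nat :=
  if pselect (exists m, `[< agree c m x `<=` U >]) is left h
  then ex_minn h else 0.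

Section rank_of_point.
Context (T : topologicalType) (E : countType) (c : nat -> T -> E) (U : set T).
Hypotheses (cc : complete_coords c) (oU : open U).

Lemma agree_rank x : U x -> agree c (rank c U x) x `<=` U.
Proof.
move=> Ux; rewrite /rank; case: pselect => [h|[]].
  by case: ex_minnP => m /asboolP.
have [m mU] := nbhs_coord cc (open_nbhs_nbhs (conj oU Ux)).
by exists m; apply/asboolP.
Qed.

(** Cylinders of length at most [rank c U x] around [x] and [y] coincide, so both minima are equal.
    Hence the rank is locally constant on [U] and can serve as a discrete coordinate. *)
Lemma rank_agree x y :
  U x -> agree c (rank c U x) x y -> rank c U y = rank c U x.
Proof.
move=> Ux xy; have xU := agree_rank Ux.
have yU : agree c (rank c U x) y `<=` U by rewrite -(agree_eq xy).
rewrite {1}/rank; case: pselect => [h|[]]; last first.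
  by exists (rank c U x); apply/asboolP.
case: ex_minnP => m /asboolP my /(_ (rank c U x)).
move=> /(_ (asboolT yU)) mr; apply/eqP; rewrite eqn_leq mr/=.
rewrite -(agree_eq (agree_le mr xy)) in my.
rewrite /rank; case: pselect => // h'.
by case: ex_minnP => k _; apply; apply/asboolP.
Qed.

End rank_of_point.

(** The word [s] prescribes the ranks, so the limit shares with an approximant from [A] a cylinder
    contained in [U i]; closedness keeps it in [X]. *)
Lemma complete_coords_Gdelta (T : topologicalType) (E : countType)
    (c : nat -> T -> E) (A X : set T) (U : nat -> set T) :
  complete_coords c -> closed X -> (forall i, open (U i)) ->
  A = X `&` \bigcap_i U i ->
  complete_coords (fun i (x : set_type A) => (c i (\val x), rank c (U i) (\val x))).
Proof.
move=> cc cX oU AE.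
have AP x : A x -> X x /\ forall i, U i x.
  by rewrite AE => -[Xx xU]; split=> // i; exact: xU.
have AU (x : set_type A) i : U i (\val x) by have [_] := AP _ (set_valP x).
have nbhsV (x : set_type A) V : nbhs (\val x) V -> nbhs x (\val @^-1` V).
  exact: (@initial_continuous _ _ set_val).
split.
- move=> i x.
  have := nbhs_agree (maxn i.+1 (rank c (U i) (\val x))) (\val x) cc.
  move=> /nbhsV; apply: filterS => y xy.
  congr pair; first by apply: xy; rewrite leq_max ltnSn.
  by rewrite (rank_agree cc (oU i) (AU x i))//; apply: agree_le xy; exact: leq_maxr.
- move=> x V; rewrite nbhsE => -[_ [[W oW <-] Wx] WV].
  have [m mW] := nbhs_coord cc (open_nbhs_nbhs (conj oW Wx)).
  by exists m => y xy; apply/WV/mW => i /xy[].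
- by move=> x y xy; apply/val_inj/(coord_inj cc) => i; have [] := xy i.
move=> s sA.
have [|x xE] := coord_lim cc (s := fun i => (s i).1).
  by move=> m; have [y yE] := sA m; exists (\val y) => i /yE <-.
have approx m : exists2 y : set_type A, agree c m (\val y) x &
    forall i, (i < m)%N -> rank c (U i) (\val y) = (s i).2.
  have [y yE] := sA m; exists y => i im; rewrite ?xE -?yE//.
have xU i : U i x /\ rank c (U i) x = (s i).2.
  (* The bound [i.+1] forces the rank of [y] to be [(s i).2]; agreement on that many coordinates
     then carries membership in [U i] from [y] to [x]. *)
  have [y yx yE] := approx (maxn i.+1 (s i).2).
  have {}yE := yE i (leq_maxl _ _).
  have {}yx : agree c (rank c (U i) (\val y)) (\val y) x.
    by rewrite yE; apply: agree_le yx; exact: leq_maxr.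
  split; first exact: agree_rank (AU y i) _ yx.
  by rewrite -yE; exact: rank_agree (AU y i) yx.
have Ax : A x.
  rewrite AE; split; last by move=> i _; case: (xU i).
  apply: cX => V /(nbhs_coord cc)[m mV].
  have [y yx _] := approx m.
  exists (\val y); split; first by have [] := AP _ (set_valP y).
  by apply: mV; rewrite -(agree_eq yx).
exists (exist _ x (mem_set Ax)) => i /=.
by rewrite xE (xU i).2 -surjective_pairing.
Qed.

(** Removing countably many closed points from [X] is a countable intersection of open conditions:
    [U i] omits the at most one point that [e] numbers [i]. *)
Lemma complete_coords_cocountable (T : topologicalType) (E : countType)
    (c : nat -> T -> E) (A X : set T) :
  complete_coords c -> closed X -> A `<=` X -> countable (X `\` A) ->
  exists d : nat -> set_type A -> E * nat, complete_coords d.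
Proof.
move=> cc cX AX /countable_injP[e e_inj].
pose U i := ~` [set x | (X `\` A) x /\ e x = i].
eexists; apply: (complete_coords_Gdelta (U := U) cc cX).
  move=> i; apply: closed_openC => x xcl.
  (* A closure point agrees in every coordinate with the only point of the set, hence equals it. *)
  have xyE y : (X `\` A) y /\ e y = i -> x = y.
    move=> [XAy ey]; apply: (coord_inj cc) => j.
    have [z [[XAz ez] xz]] := xcl _ (coord_near cc j x).
    rewrite xz; congr (c j _); apply: e_inj; rewrite ?inE//; congruence.
  have [y [yP _]] := xcl _ filterT.
  by rewrite /= (xyE _ yP).
apply/seteqP; split=> [x Ax|x [Xx xU]].
  by split; [exact: AX|move=> i _ [[]]].
by apply: contrapT => nAx; apply: (xU (e x)).
Qed.

(** * Coordinates on I(N) *)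

(** The inverse is recorded too because finitely many values of [f] never decide that a point lies
    outside [im f], as [w2] demands. *)
Definition pbij_coord (i : nat) (f : pbij) : option nat * option nat :=
  (f i, pbij_inv f i).

Lemma pbij_inv_None (f : pbij) y : pbij_inv f y = None <-> ~ im f y.
Proof.
split=> [fy [x /pinvP]|fy]; first by rewrite [Defs.pinv f y]fy.
by case fyE: (pbij_inv f y) => [x|//]; case: fy; exists x; apply/pinvP.
Qed.

Lemma pfun_None (f : pbij) x : f x = None <-> ~ dom f x.
Proof.
split=> [fx [y]|fx]; first by rewrite fx.
by case fxE: (f x) => [y|//]; case: fx; exists y.
Qed.

Lemma nbhs_subbase (V : set pbij) f : tau_pp_subbase V -> V f -> nbhs f V.
Proof.
move=> sV Vf; apply: open_nbhs_nbhs; split=> //.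
exists [set V]; last by rewrite bigcup_set1.
by move=> _ ->; exact: finI_from1.
Qed.

Lemma pbij_coord_complete : complete_coords pbij_coord.
Proof.
split.
- move=> i f.
  have fi : \forall g \near f, f i = (g : pbij) i.
    case fE: (f i) => [y|].
      have : nbhs f (v i y) by apply: nbhs_subbase => //; left; left; exists (i, y).
      by apply: filterS => g.
    have : nbhs f (w1 i).
      by apply: nbhs_subbase; [left; right; exists i|apply/pfun_None].
    by apply: filterS => g /pfun_None.
  have fV : \forall g \near f, pbij_inv f i = pbij_inv g i.
    case fE: (pbij_inv f i) => [x|].
      have : nbhs f (v x i).
        by apply: nbhs_subbase; [left; left; exists (x, i)|exact/pinvP].
      by apply: filterS => g /pinvP.
    have : nbhs f (w2 i).
      by apply: nbhs_subbase; [right; exists i|exact/pbij_inv_None].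
    by apply: filterS => g /pbij_inv_None.
  by apply: filterS2 fi fV => g; rewrite /pbij_coord => -> ->.
- move=> f U; rewrite nbhsE => -[_ [[D' D'sub <-] [A D'A Af]] sU].
  have [S Ssub AE] := D'sub _ D'A.
  (* The cylinders around [f] form a filter, which reduces finite intersections to a single subbasic
     set. *)
  pose F : set_system pbij := filter_from setT (fun m => agree pbij_coord m f).
  have FF : Filter F.
    apply: filter_from_filter; first by exists 0%N.
    move=> i j _ _; exists (maxn i j) => // g fg.
    by split; apply: agree_le fg; rewrite ?leq_maxl ?leq_maxr.
  have [m _ mA] : F A.
    rewrite -AE; apply: filter_bigI => V VS.
    have Vf : V f by move: Af; rewrite -AE; apply.
    have /= := Ssub _ VS; rewrite inE => -[[[[x y] _ /= VE]|[x _ VE]]|[y _ VE]].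
    + exists x.+1 => // g /(_ x (ltnSn x))[fg _]; move: Vf.
      by rewrite -VE /v/= fg.
    + exists x.+1 => // g /(_ x (ltnSn x))[fg _]; move: Vf.
      by rewrite -VE => /pfun_None fx; apply/pfun_None; rewrite -fg.
    + exists y.+1 => // g /(_ y (ltnSn y))[_ fg]; move: Vf; rewrite -VE.
      move=> /pbij_inv_None fy; apply/pbij_inv_None.
      by rewrite /= -fg; exact: fy.
  by exists m => g fg; apply: sU; exists A => //; exact: mA.
- by move=> f g fg; apply: pbij_ext => i; have [] := fg i.
move=> s sP.
have sE m : exists g : pbij, forall i, (i < m)%N ->
    g i = (s i).1 /\ pbij_inv g i = (s i).2.
  by have [g gE] := sP m; exists g => i /gE <-.
(* Injectivity, like the inverse relation [sV] below, concerns two indices at a time, so an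
   approximant correct beyond both settles it. *)
have s_inj x y z : (s x).1 = Some z -> (s y).1 = Some z -> x = y.
  have [g gE] := sE (maxn x y).+1.
  rewrite -(gE x _).1 ?ltnS ?leq_maxl// -(gE y _).1 ?ltnS ?leq_maxr//.
  exact: pfun_inj.
exists (PBij s_inj) => i; rewrite [RHS]surjective_pairing; congr pair => /=.
have sV x : (s x).1 = Some i <-> (s i).2 = Some x.
  have [g gE] := sE (maxn x i).+1.
  rewrite -(gE x _).1 ?ltnS ?leq_maxl// -(gE i _).2 ?ltnS ?leq_maxr//.
  by rewrite /= pinvP.
case si: (s i).2 => [x|]; first by apply/pinvP/sV.
by apply/pbij_inv_None => -[x /sV]; rewrite si.
Qed.

(** * Rank of composites and inverses; countability in finite rank *)

Local Open Scope card_scope.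

Lemma card_dom_comp (f g : pbij) : dom (pbij_comp f g) #<= dom f `&` im g.
Proof.
(* The inverse of [g] maps [dom f] meet [im g] onto the domain of the composite; the default [0]
   never occurs on [im g]. *)
apply: card_le_trans (card_image_le (fun y => odflt 0%N (pbij_inv g y)) _).
apply: subset_card_le; rewrite dom_pbij_comp => x [y gx fy].
by exists y => //=; have /pinvP := gx; rewrite /= => ->.
Qed.

Lemma card_im (f : pbij) : im f #<= dom f.
Proof.
apply: card_le_trans (card_image_le (fun x => odflt 0%N (f x)) _).
by apply: subset_card_le => y [x fx]; exists x; [exists y|rewrite fx].
Qed.

Lemma Sinfty_comp (B : set nat) f g :
  Sinfty B f -> Sinfty B g -> Sinfty B (pbij_comp f g).
Proof.
move=> [df imf] [dg img]; split.
  rewrite dom_pbij_comp df img; apply/seteqP; split=> x.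
    by case=> y gx _; rewrite -dg; exists y.
  move=> Bx; have [y gx] : dom g x by rewrite dg.
  exists y => //.
  by rewrite setIid -img; exists x.
apply/seteqP; split=> z.
  move=> [x]; rewrite /= /pcomp; case: (g x) => //= y fy.
  by rewrite -imf; exists y.
move=> Bz; have [y fy] : im f z by rewrite imf.
have [x gx] : im g y by rewrite img -df; exists z.
by exists x; rewrite /= /pcomp gx.
Qed.

Lemma Sinfty_inv (B : set nat) f : Sinfty B f -> Sinfty B (pbij_inv f).
Proof. by rewrite /Sinfty/= dom_pbij_inv im_pbij_inv => -[]. Qed.

(** A partial bijection is determined by its graph, here a finite subset of a countable set. *)
Lemma countable_finite_dom : countable [set f : pbij | finite_set (dom f)].
Proof.
have /countable_injP[h h_inj] :=
  countable_finite_subset (countableP [set: nat * nat]).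
pose graph (f : pbij) := [set xy : nat * nat | f xy.1 = Some xy.2].
have graph_finite f : finite_set (dom f) -> finite_set (graph f).
  move=> /(finite_image (fun x => (x, odflt 0%N (f x)))).
  apply: sub_finite_set => -[x y] fx.
  by exists x; [exists y|rewrite [f x]fx].
apply/countable_injP; exists (h \o graph) => f g; rewrite !inE => fF gF fg.
have {}fg : graph f = graph g by apply: h_inj; rewrite ?inE//=; split=> //;
  exact: graph_finite.
have fgP x y : f x = Some y <-> g x = Some y.
  by rewrite -[f x = _]/(graph f (x, y)) fg.
apply: pbij_ext => x; case fx: (f x) => [y|]; first by apply/esym/fgP.
by case gx: (g x) => [y|//]; move: gx fx => /fgP ->.
Qed.

(** Makes rank above [n] visible to finitely many coordinates: any [n.+1] elements of [A] are
    bounded. *)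
Lemma card_le_initial (A : set nat) n :
  (forall m, A `&` `I_m #<= `I_n) -> A #<= `I_n.
Proof.
move=> An.
have bounded (X : {fset nat}) : exists m, [set` X] `<=` `I_m.
  exists (\max_(x <- X) x).+1 => x xX /=; rewrite ltnS.
  exact: (@leq_bigmax_seq _ _ predT id).
have [fA|/(infinite_set_fset n.+1)[X XA nX]] := pselect (finite_set A).
  have [m Am] := bounded (fset_set A).
  rewrite -(setIidl (B := `I_m) (A := A)); first exact: An.
  by rewrite fset_setK in Am.
have [m Xm] := bounded X.
have : [set` X] #<= `I_n.
  by apply: card_le_trans (An m); apply: subset_card_le => x xX; split;
    [exact: XA|exact: Xm].
by move=> /geq_card_fset_set; rewrite set_fsetK leqNgt nX.
Qed.

(** * The closed inverse semigroup containing the generators *)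

Lemma closed_low_rank_or_Sinfty (B : nat -> set nat) (n : nat) :
  (forall i j, i <> j -> B i `&` B j #<= `I_n) ->
  closed ([set f : pbij | dom f #<= `I_n] `|` \bigcup_i Sinfty (B i)).
Proof.
move=> Bn f fcl; have approx m := fcl _ (nbhs_agree m f pbij_coord_complete).
have [fn|fn] := boolP (dom f #<= `I_n); [by left|right].
have [m fm] : exists m, ~ (dom f `&` `I_m #<= `I_n).
  by apply: contrapT => /forallNP h; move: fn => /negP; apply;
    apply: card_le_initial => m; apply: contrapT.
(* An approximant agreeing with [f] up to [k >= m] is defined on all of [dom f] below [m], so its
   rank exceeds [n] and it lies in some [Sinfty (B i)]. *)
have approxS k : (m <= k)%N -> exists g i,
    [/\ agree pbij_coord k f g, Sinfty (B i) g & dom f `&` `I_m `<=` B i].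
  move=> mk; have [g [Xg fg]] := approx k.
  have fgm : dom f `&` `I_m `<=` dom g.
    move=> x [[y fx] /= xm]; exists y.
    by have [<-] := fg x (leq_trans xm mk).
  case: Xg => [/= gn|[i _ [dg ig]]].
    by case: fm; exact: card_le_trans (subset_card_le fgm) gn.
  by exists g, i; split=> //; rewrite -dg.
have [_ [i [_ _ fBi]]] := approxS m (leqnn m).
(* The index [i] is the same for all [k]: two distinct members of the family share too few points to
   both contain [dom f] below [m]. *)
have {}approxS k : exists2 g, agree pbij_coord k f g & Sinfty (B i) g.
  have [g [j [fg gB fBj]]] := approxS (maxn m k) (leq_maxl _ _).
  exists g; first by apply: agree_le fg; exact: leq_maxr.
  suff -> : i = j by [].
  apply: contrapT => /Bn; apply: contra_not fm.
  by apply: card_le_trans; apply: subset_card_le => x fx; split; auto.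
have dom_approx x : dom f x <-> B i x.
  have [g /(_ x (ltnSn x))[fx _] [<- _]] := approxS x.+1.
  by rewrite /dom/= fx.
have im_approx y : im f y <-> B i y.
  have [g /(_ y (ltnSn y))[_ fy] [_ <-]] := approxS y.+1.
  by rewrite -!dom_pbij_inv /dom/= fy.
by exists i => //; split; apply/seteqP; split=> x;
  [move/dom_approx|move/dom_approx|move/im_approx|move/im_approx].
Qed.

Lemma low_rank_or_Sinfty_semigroup (B : nat -> set nat) (n : nat) :
  (forall i j, i <> j -> B i `&` B j #<= `I_n) ->
  inverse_subsemigroup
    ([set f : pbij | dom f #<= `I_n] `|` \bigcup_i Sinfty (B i)).
Proof.
move=> Bn; split=> [f g|f [/= fn|[i _ fB]]]; last first.
- by right; exists i => //; exact: Sinfty_inv.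
- by left; rewrite /= dom_pbij_inv; exact: card_le_trans (card_im f) fn.
case=> [/= fn _|[i _ fB]].
  left; apply: card_le_trans (card_dom_comp f g) _.
  by apply: card_le_trans fn; apply: subset_card_le; exact: subIsetl.
case=> [/= gn|[j _ gB]].
  left; apply: card_le_trans (card_dom_comp f g) _; apply: card_le_trans gn.
  by apply: card_le_trans (card_im g); apply: subset_card_le; exact: subIsetr.
have [ij|/eqP/Bn] := eqVneq i j.
  by right; exists i => //; apply: Sinfty_comp => //; rewrite ij.
case: fB gB => <- _ [_ <-] fgn.
by left; exact: card_le_trans (card_dom_comp f g) fgn.
Qed.

Theorem theorem4p4 (R : realType) (B : nat -> set nat) (n : nat)
  (infB : forall i : nat, infinite_set (B i))
  (cardB : forall i j : nat, i <> j -> (B i `&` B j #= `I_n)%card) :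
  polish R
    (set_type
      (generated_inverse_subsemigroup (\bigcup_(i : nat) Sinfty (B i)))).
Proof.
have Bn i j : i <> j -> B i `&` B j #<= `I_n.
  by move=> /cardB; rewrite card_eq_le => /andP[].
set G := generated_inverse_subsemigroup _.
pose X := [set f : pbij | dom f #<= `I_n] `|` \bigcup_i Sinfty (B i).
have GX : G `<=` X.
  apply: smallest_sub; first exact: low_rank_or_Sinfty_semigroup.
  exact: subsetUr.
have BG : \bigcup_i Sinfty (B i) `<=` G by exact: sub_smallest.
have XGc : countable (X `\` G).
  apply: sub_countable countable_finite_dom; apply: subset_card_le.
  (* [BG] rules out the second half of [X], which leaves only maps of rank at most [n]. *)
  by move=> f [[/= fn _|/BG//]]; apply/finite_set_leP; exists n.
have [d dc] := complete_coords_cocountable pbij_coord_complete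
  (closed_low_rank_or_Sinfty Bn) GX XGc.
exact: polish_complete_coords dc.
Qed.
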